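(* Let $(E(t))_{t\ge 0}$ be a well posed nonlinear semigroup on a normed vector space $(X,\|\cdot\|)$. Let $\mathcal{C}$ be a condition of type $(\mathcal{C})$, that is, a property of numerical methods associated with the semigroup such that every numerical method which satisfies $\mathcal{C}$ and is distantly stable is also locally stable. Let $(C_{\Delta t})_{\Delta t\ge 0}$ be a numerical method associated with $(E(t))$ which is consistent with $(E(t))$ and satisfies $\mathcal{C}$. Then $(C_{\Delta t})$ is convergent to the nonlinear semigroup $(E(t))$ if and only if it is stable.
   Context: Let $(X,\|\cdot\|)$ be a normed vector space. Nonlinear semigroup: a family of (not necessarily linear) mappings $E(t):X_t\to X$, $t\in[0,\infty)$, where the sets $X_t$ satisfy $X_{t+s}\subseteq X_t\subseteq X$ for all $t,s\in[0,\infty)$, $E(0)=\mathrm{id}_{X_0}$, and for all $t,s\in[0,\infty)$ one has $E(t)X_{t+s}\subseteq X_s$ and $E(t+s)u=E(s)E(t)u$ for every $u\in X_{t+s}$. Put $Z=\bigcup_{t\in[0,\infty)}\{t\}\times X_t\subseteq[0,\infty)\times X$. Well posed: the mapping $Z\ni(t,u)\mapsto E(t)u\in X$ is continuous. Numerical method associated with a well posed nonlinear semigroup: a continuous mapping $[0,\infty)\times X\ni(\Delta t,u)\mapsto C_{\Delta t}u\in X$ with $C_0=\mathrm{id}_X$. $C_{\Delta t}^n$ denotes the $n$-fold iterate of $C_{\Delta t}$. Regular subset: a subset $Z'\subseteq Z$ is regular if, writing $X'_t=\{u\in X_t : (t,u)\in Z'\}$ for $t\in[0,\infty)$, the following hold: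 $Z'$ is closed in $[0,\infty)\times X$; $E(t)X'_{t+s}\subseteq X'_s$ for all $t,s\in[0,\infty)$; $C_{\Delta t}X'_{t+\Delta t}\subseteq X'_t$ for all $t,\Delta t\in[0,\infty)$. Below, $X'_t$ always refers to the regular set $Z'$ under consideration. Locally stable: for every regular $Z'\subseteq Z$, $T\in(0,\infty)$ and compact $K\subseteq X$ there exist $L',\rho'>0$ such that for all $\Delta t>0$, $n\in\mathbb{N}$ and $u,v\in K\cap X'_{n\Delta t}$: if $n\Delta t\le T$ and $\|v-u\|\le\rho'$, then $\|C_{\Delta t}^n v-C_{\Delta t}^n u\|\le L'\|v-u\|$. Distantly stable: for every regular $Z'\subseteq Z$, $T\in(0,\infty)$, compact $K\subseteq X$ and $\rho>0$ there exists $L''>0$ such that for all $\Delta t>0$, $n\in\mathbb{N}$ and $u,v\in K\cap X'_{n\Delta t}$: if $n\Delta t\le T$ and $\|v-u\|\ge\rho$, then $\|C_{\Delta t}^n v-C_{\Delta t}^n u\|\le L''\|v-u\|$. Stable: for every regular $Z'\subseteq Z$, $T\in(0,\infty)$ and compact $K\subseteq X$ there exists $L>0$ such that for all $\Delta t>0$, $n\in\mathbb{N}$ and $u,v\in K\cap X'_{n\Delta t}$: if $n\Delta t\le T$, then $\|C_{\Delta t}^n v-C_{\Delta t}^n u\|\le L\|v-u\|$. Consistent (with the semigroup): for every regular $Z'\subseteq Z$, $T\in(0,\infty)$, compact $K\subseteq X$ and $\epsilon>0$ there exists $\delta>0$ such that for all $t\in[0,T]$, $\Delta t>0$ and $u\in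 K\cap X'_{t+\Delta t}$: if $\Delta t\le\delta$, then $\|C_{\Delta t}E(t)u-E(\Delta t)E(t)u\|\le\epsilon\,\Delta t$. Convergent (to the semigroup): for every regular $Z'\subseteq Z$, $T\in(0,\infty)$, compact $K\subseteq X$ and $\epsilon>0$ there exists $\theta>0$ such that for all $t\in[0,T]$, $\Delta t>0$, $n\in\mathbb{N}$ and $u\in K\cap X'_t\cap X'_{n\Delta t}$: if $\Delta t\le\theta$ and $|t-n\Delta t|\le\theta$, then $\|E(t)u-C_{\Delta t}^n u\|\le\epsilon$. *)

(* Defs.v *)
From HB Require Import structures.
From mathcomp Require Import all_boot all_order all_algebra.
From mathcomp Require Import all_classical all_reals all_analysis.

Set Implicit Arguments.
Unset Strict Implicit.
Unset Printing Implicit Defensive.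

Import Order.TTheory GRing.Theory Num.Theory.
Import numFieldNormedType.Exports.

Local Open Scope classical_set_scope.
Local Open Scope ring_scope.

(* Partial maps are encoded as total functions.  A mapping E(t) : X_t -> X,
   t >= 0, is a pair of D : R -> set X and E : R -> X -> X with D t = X_t;
   values of D and E at t < 0, and of E t outside D t, are never used.
   Likewise only the values of a method C : R -> X -> X at nonnegative times
   are used. *)

Section Definitions.
Context {R : realType} {X : normedModType R}.
Implicit Types (D : R -> set X) (E C : R -> X -> X).

Definition time_space : set (R * X) := [set p | 0 <= p.1].

Record nonlinear_semigroup D E : Prop := {
  semigroup_dom : forall t s : R, 0 <= t -> 0 <= s -> D (t + s) `<=` D t ;
  semigroup_id : forall u, D 0 u -> E 0 u = u ;
  semigroup_maps : forall t s : R, 0 <= t -> 0 <= s ->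
    E t @` D (t + s) `<=` D s ;
  semigroup_add : forall t s : R, 0 <= t -> 0 <= s ->
    forall u, D (t + s) u -> E (t + s) u = E s (E t u) }.

Definition graph_dom D : set (R * X) := [set p | 0 <= p.1 /\ D p.1 p.2].

Definition well_posed D E : Prop :=
  {within graph_dom D, continuous (fun p : R * X => E p.1 p.2)}.

Definition numerical_method C : Prop :=
  {within time_space, continuous (fun p : R * X => C p.1 p.2)} /\
  (forall u, C 0 u = u).

Definition slice D (Z' : set (R * X)) (t : R) : set X := [set u | D t u /\ Z' (t, u)].

Record regular D E C (Z' : set (R * X)) : Prop := {
  regular_sub : Z' `<=` graph_dom D ;
  (* relative closedness in [0, oo) x X *)
  regular_closed : closed (Z' : set (subspace time_space)) ;
  regular_semigroup : forall t s : R, 0 <= t -> 0 <= s ->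
    E t @` slice D Z' (t + s) `<=` slice D Z' s ;
  regular_method : forall t dt : R, 0 <= t -> 0 <= dt ->
    C dt @` slice D Z' (t + dt) `<=` slice D Z' t }.

Definition locally_stable D E C : Prop :=
  forall Z', regular D E C Z' ->
  forall T : R, 0 < T -> forall K : set X, compact K ->
  exists L' rho' : R, [/\ 0 < L', 0 < rho' &
    forall (dt : R) (n : nat) (u v : X), 0 < dt ->
      (K `&` slice D Z' (n%:R * dt)) u -> (K `&` slice D Z' (n%:R * dt)) v ->
      n%:R * dt <= T -> `|v - u| <= rho' ->
      `|iter n (C dt) v - iter n (C dt) u| <= L' * `|v - u|].

Definition distantly_stable D E C : Prop :=
  forall Z', regular D E C Z' ->
  forall T : R, 0 < T -> forall K : set X, compact K ->
  forall rho : R, 0 < rho ->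
  exists2 L'' : R, 0 < L'' &
    forall (dt : R) (n : nat) (u v : X), 0 < dt ->
      (K `&` slice D Z' (n%:R * dt)) u -> (K `&` slice D Z' (n%:R * dt)) v ->
      n%:R * dt <= T -> rho <= `|v - u| ->
      `|iter n (C dt) v - iter n (C dt) u| <= L'' * `|v - u|.

Definition stable D E C : Prop :=
  forall Z', regular D E C Z' ->
  forall T : R, 0 < T -> forall K : set X, compact K ->
  exists2 L : R, 0 < L &
    forall (dt : R) (n : nat) (u v : X), 0 < dt ->
      (K `&` slice D Z' (n%:R * dt)) u -> (K `&` slice D Z' (n%:R * dt)) v ->
      n%:R * dt <= T ->
      `|iter n (C dt) v - iter n (C dt) u| <= L * `|v - u|.

Definition consistent D E C : Prop :=
  forall Z', regular D E C Z' ->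
  forall T : R, 0 < T -> forall K : set X, compact K ->
  forall eps : R, 0 < eps ->
  exists2 delta : R, 0 < delta &
    forall (t dt : R) (u : X), 0 <= t <= T -> 0 < dt ->
      (K `&` slice D Z' (t + dt)) u -> dt <= delta ->
      `|C dt (E t u) - E dt (E t u)| <= eps * dt.

Definition convergent D E C : Prop :=
  forall Z', regular D E C Z' ->
  forall T : R, 0 < T -> forall K : set X, compact K ->
  forall eps : R, 0 < eps ->
  exists2 theta : R, 0 < theta &
    forall (t dt : R) (n : nat) (u : X), 0 <= t <= T -> 0 < dt ->
      (K `&` slice D Z' t `&` slice D Z' (n%:R * dt)) u ->
      dt <= theta -> `|t - n%:R * dt| <= theta ->
      `|E t u - iter n (C dt) u| <= eps.

(* P may be any predicate, including one that inspects the irrelevant values of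
   C at negative times: properties of genuine methods are a special case. *)
Definition condition_of_type_C D E (P : (R -> X -> X) -> Prop) : Prop :=
  forall C, numerical_method C -> P C -> distantly_stable D E C ->
  locally_stable D E C.

End Definitions.

(* Main.v *)
Require Import Defs.
From mathcomp Require Import all_boot all_order all_algebra.
From mathcomp Require Import all_classical all_reals all_analysis.
From mathcomp Require Import lra ring.

(** This is a nonlinear Lax equivalence theorem.

    Convergence implies stability.  For initial data in a compact set and final
    times at most [T], the iterates of a convergent method stay in a bounded set
    ([convergent_iterates_bounded]): for small steps they are within distance 1
    of the semigroup, whose values on a compact set of pairs (time, datum) are
    bounded; for large steps only boundedly many iterations fit in [[0, T]], and
    these keep the data in a fixed compact set.  If every iterate has norm at
    most [M], two iterates starting at distance at least [rho] differ by at most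
    [2M], that is, by at most [2M / rho] times their initial distance, which is
    distant stability.  The condition on the method turns it into local
    stability, and the two together are stability.

    Stability and consistency imply convergence.  The global error
    [E(n dt)u - C^n u] is a telescoping sum of terms
    [C^m (E(dt) v) - C^m (C v)] with [v = E(k dt)u] and [k + 1 + m = n].
    Consistency makes [E(dt) v - C v] at most [e dt], stability multiplies this
    by at most a constant [L], and the [n] terms add up to at most [L e n dt]
    ([telescoping_error]).  The uniform continuity of [E] on a compact set then
    replaces [n dt] by a nearby time [t].

    One difficulty is hidden in this sketch.  A regular set [Z'] may contain
    [(t, u)] without containing [(s, u)] for [s < t], whereas consistency at
    time [k dt] is only available for data in the slice at time [(k + 1) dt].
    The second half therefore replaces [Z'] by
    [{(s, u) | (t, u) in Z' for some t in [s, T + 1]}], whose slices decrease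
    with time and which is still regular
    ([regular_bounded_lower_closure]). *)

Set Implicit Arguments.
Unset Strict Implicit.
Unset Printing Implicit Defensive.

Import Order.TTheory GRing.Theory Num.Theory.
Import numFieldNormedType.Exports.

Local Open Scope classical_set_scope.
Local Open Scope ring_scope.

(** * Compact sets *)

Lemma compact_norm_le (R : realType) (X : normedModType R) (K : set X) :
  compact K -> exists2 M : R, 0 < M & forall x, K x -> `|x| <= M.
Proof.
by move=> /compact_bounded /pinfty_ex_gt0 [M M0 KM]; exists M.
Qed.

(** Heine-Cantor relative to a subset.  The radius is obtained by letting [d]
    tend to 0 from the right as the parameter of the near-covering form of
    compactness of [A]. *)
Lemma compact_within_unif_continuous (R : realType) (V : normedModType R)
    (T : pseudoMetricType R) (A : set T) (f : T -> V) (e : R) :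
  compact A -> {within A, continuous f} -> 0 < e ->
  exists2 d : R, 0 < d &
    forall p q, A p -> A q -> ball p d q -> `|f p - f q| <= e.
Proof.
move=> /compact_near_coveringP/near_covering_withinP cA cf e0.
pose good (d : R) (p : T) :=
  forall q, A q -> ball p d q -> `|f p - f q| <= e.
have near_good : \forall d \near (0 : R)^'+, A `<=` good d.
  apply: cA => p Ap.
  have /subspace_continuousP /(_ p Ap) /cvgrPdist_le /(_ (e / 2)) := cf.
  rewrite divr_gt0// => /(_ isT); rewrite nearE /within /= => fp.
  have /nbhs_ballP [r /= r0 rP] := fp.
  exists (ball p (r / 2), [set d | d < r / 2]) => /=.
    split; first by apply/nbhs_ballP; exists (r / 2) => //=; rewrite divr_gt0.
    by apply: nbhs_right_lt; rewrite divr_gt0.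
  move=> [p' d] /= [pp' dr] Ap' q Aq p'q.
  (* Both p' and q are within r of p, so f at each is close to f p. *)
  have fpp' : `|f p - f p'| <= e / 2.
    by apply: rP => //; apply: le_ball pp'; rewrite ler_pdivrMr//; lra.
  have fpq : `|f p - f q| <= e / 2.
    apply: rP => //; rewrite (splitr r); apply: ball_triangle pp' _.
    exact: le_ball (ltW dr) _ p'q.
  have -> : f p' - f q = (f p - f q) - (f p - f p').
    by rewrite opprB [RHS]addrC addrA subrK.
  rewrite (splitr e); apply: le_trans (ler_normB _ _) _; exact: lerD.
have [d [d0 dP]] : exists d : R, 0 < d /\ A `<=` good d.
  have d_gt0 : \forall d \near (0 : R)^'+, 0 < d by exact: nbhs_right_gt.
  exact: (filter_ex (filterI d_gt0 near_good)).
by exists d => // p q Ap; exact: dP.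
Qed.

(** * Closing a regular set under earlier times *)

(** The bound [T] on the later time [t] makes this a projection along a compact
    interval, so that it preserves closedness. *)
Definition bounded_lower_closure (R : realType) (X : normedModType R) (T : R)
    (Z' : set (R * X)) : set (R * X) :=
  [set p | 0 <= p.1 /\ exists2 t, p.1 <= t <= T & Z' (t, p.2)].

(** The projection of a closed set along the compact interval [[0, T]] is closed:
    if no [t] in the interval witnesses that [p] belongs to it, then by
    compactness none does for the points near [p]. *)
Lemma bounded_lower_closure_closed (R : realType) (X : normedModType R)
    (T : R) (Z' : set (R * X)) :
  closed Z' -> closed (bounded_lower_closure T Z').
Proof.
move=> cZ.
pose S : set (R * (R * X)) :=
  (fun z => z.2.1) @^-1` [set s | 0 <= s] `&`
  ((fun z => z.1 - z.2.1) @^-1` [set s | 0 <= s] `&`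
   (fun z => (z.1, z.2.2)) @^-1` Z').
have c1 : continuous (fun z : R * (R * X) => z.2.1).
  move=> z; apply: (cvg_comp snd fst); [exact: cvg_snd|exact: cvg_fst].
have c2 : continuous (fun z : R * (R * X) => z.2.2).
  move=> z; apply: (cvg_comp snd snd); [exact: cvg_snd|exact: cvg_snd].
have c0 : closed [set s : R | 0 <= s] by exact: closed_ge.
have cS : closed S.
  apply: closedI; last apply: closedI.
  - by apply: (preimage_closed _ c0) => z _; exact: c1.
  - apply: (preimage_closed _ c0) => z _.
    by apply: cvgB; [exact: cvg_fst|exact: c1].
  - apply: (preimage_closed _ cZ) => z _.
    by apply: (cvg_pair (G := nbhs z.1) (H := nbhs z.2.2));
      [exact: cvg_fst|exact: c2].
rewrite -[X in closed X]setCK; apply: open_closedC.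
rewrite openE => p /= pN.
have /compact_near_coveringP cI := @segment_compact R 0 T.
have oS : open (~` S) by exact: (closed_openC cS).
have nearN : \forall q \near p, `[0, T] `<=` (fun t => ~ S (t, q)).
  apply: (cI _ (nbhs p) (fun q t => ~ S (t, q))) => t /=.
  rewrite in_itv /= => /andP[t0 tT].
  apply: (open_nbhs_nbhs (p := (t, p))); split => //= -[/= p0 [pt Zt]].
  apply: pN; split => //; exists t => //.
  by rewrite tT andbT -subr_ge0.
apply: filterS nearN => q qN [q0 [t /andP[qt tT] Zt]].
apply: (qN t); first by rewrite /= in_itv /= tT (le_trans q0 qt).
by split=> //=; split=> //=; rewrite subr_ge0.
Qed.

Section SemigroupAndMethod.
Context {R : realType} {X : normedModType R}.
Implicit Types (D : R -> set X) (E C : R -> X -> X).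

(** Closed relative to [[0, oo) x X] is the same as closed, as [[0, oo) x X] is
    itself closed. *)
Lemma regular_set_closed D E C (Z' : set (R * X)) :
  regular D E C Z' -> closed Z'.
Proof.
move=> rZ.
have /closed_subspaceP[V cV VZ] := regular_closed rZ.
have -> : Z' = V `&` time_space.
  by rewrite VZ; apply/esym/setIidl => p /(regular_sub rZ)[].
apply: closedI => //.
have c0 : closed [set s : R | 0 <= s] by exact: closed_ge.
by apply: (preimage_closed _ c0) => z _; exact: cvg_fst.
Qed.

(** If [(r, u)] in [Z'] witnesses membership at a time [t + s <= r], then running
    the semigroup or the method for time [t] leads to a point of [Z'] at time
    [r - t], which lies in [[s, T]] and is the new witness. *)
Lemma regular_bounded_lower_closure D E C (Z' : set (R * X)) (T : R) :
  nonlinear_semigroup D E -> regular D E C Z' ->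
  regular D E C (bounded_lower_closure T Z').
Proof.
move=> hE rZ.
have dom s t u : 0 <= s -> s <= t -> Z' (t, u) -> D s u /\ D t u.
  move=> s0 st /(regular_sub rZ)[/= t0 Dt]; split=> //.
  apply: (semigroup_dom hE s0 (s := t - s)); first by rewrite subr_ge0.
  by rewrite addrC subrK.
split.
- move=> [s u] [/= s0 [t /andP[st tT] Zt]]; split=> //.
  by case: (dom _ _ _ s0 st Zt).
- apply: closed_subspaceW; apply: bounded_lower_closure_closed.
  exact: regular_set_closed rZ.
- move=> t s t0 s0 _ [u [_ [/= _ [r /andP[tsr rT] Zr]]] <-].
  have rt : s <= r - t by rewrite lerBrDl.
  have [_ Dr] := dom _ _ _ (addr_ge0 t0 s0) tsr Zr.
  have : slice D Z' (r - t) (E t u).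
    apply: (regular_semigroup rZ t0); first exact: le_trans s0 rt.
    by exists u => //; rewrite addrC subrK; split.
  move=> [_ ZE]; split; first by case: (dom _ _ _ s0 rt ZE).
  split=> //; exists (r - t) => //=; rewrite rt /= lerBlDr.
  by rewrite (le_trans rT)// lerDl.
- move=> t dt t0 dt0 _ [u [_ [/= _ [r /andP[tsr rT] Zr]]] <-].
  have rt : t <= r - dt by rewrite lerBrDr.
  have [_ Dr] := dom _ _ _ (addr_ge0 t0 dt0) tsr Zr.
  have : slice D Z' (r - dt) (C dt u).
    apply: (regular_method rZ _ dt0); first exact: le_trans t0 rt.
    by exists u => //; rewrite subrK; split.
  move=> [_ ZC]; split; first by case: (dom _ _ _ t0 rt ZC).
  split=> //; exists (r - dt) => //=; rewrite rt /= lerBlDr.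
  by rewrite (le_trans rT)// lerDl.
Qed.

(** * Boundedness of the iterates of a convergent method *)

Definition compact_part (T : R) (K : set X) (Z' : set (R * X)) : set (R * X) :=
  (`[0, T] `*` K) `&` Z'.

Lemma compact_part_compact (T : R) (K : set X) (Z' : set (R * X)) :
  compact K -> closed Z' -> compact (compact_part T K Z').
Proof.
move=> cK cZ; apply: compact_closedI cZ.
by apply: compact_setX => //; exact: segment_compact.
Qed.

Lemma compact_part_well_posed D E C (T : R) (K : set X) (Z' : set (R * X)) :
  well_posed D E -> regular D E C Z' ->
  {within compact_part T K Z', continuous (fun p : R * X => E p.1 p.2)}.
Proof.
by move=> wp rZ; apply: continuous_subspaceW wp => p [_ /(regular_sub rZ)].
Qed.

Lemma method_image_compact C (T : R) (K : set X) :
  numerical_method C -> compact K ->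
  compact ((fun p : R * X => C p.1 p.2) @` (`[0, T] `*` K)).
Proof.
move=> [cC _] cK; apply: continuous_compact.
  by apply: continuous_subspaceW cC => p [/=]; rewrite in_itv => /andP[].
by apply: compact_setX => //; exact: segment_compact.
Qed.

(** The compact set is enlarged [N] times by the image of [[0, T] x K'] under the
    method.  For [n = 0] the hypothesis on [n dt] does not bound [dt], and the
    zeroth iterate is in [K] itself. *)
Lemma iterates_in_compact C (T : R) (K : set X) (N : nat) :
  numerical_method C -> compact K ->
  exists2 K', compact K' & forall (dt : R) (n : nat) u, (n <= N)%N ->
    0 <= dt -> n%:R * dt <= T -> K u -> K' (iter n (C dt) u).
Proof.
move=> hC cK; elim: N => [|N [K' cK' K'P]].
  by exists K => // dt [].
exists (K `|` (fun p : R * X => C p.1 p.2) @` (`[0, T] `*` K')).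
  by apply: compactU => //; exact: method_image_compact.
move=> dt [|n] u nN dt0 nT Ku; first by left.
have ndt0 : 0 <= n%:R * dt by rewrite mulr_ge0.
move: nT; rewrite -natr1 mulrDl mul1r => nT.
right; exists (dt, iter n (C dt) u) => //; split => /=.
  by rewrite in_itv /= dt0 /=; lra.
by apply: K'P => //; lra.
Qed.

(** Convergence with accuracy 1 controls the steps [dt <= theta]; when
    [dt > theta], the number of iterations is at most [T / theta]. *)
Lemma convergent_iterates_bounded D E C (Z' : set (R * X)) (T : R) (K : set X) :
  well_posed D E -> numerical_method C -> convergent D E C ->
  regular D E C Z' -> 0 < T -> compact K ->
  exists2 M : R, 0 < M & forall (dt : R) (n : nat) u, 0 < dt ->
    (K `&` slice D Z' (n%:R * dt)) u -> n%:R * dt <= T ->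
    `|iter n (C dt) u| <= M.
Proof.
move=> wp hC conv rZ T0 cK.
have [theta theta0 thetaP] := conv _ rZ _ T0 _ cK _ ltr01.
have cA := compact_part_compact (T := T) cK (regular_set_closed rZ).
have cE := compact_part_well_posed (T := T) (K := K) wp rZ.
have [M1 M10 M1P] := compact_norm_le (continuous_compact cE cA).
pose N := (Num.trunc (T / theta)).+1.
have [K' cK' K'P] := iterates_in_compact T N hC cK.
have [M2 M20 M2P] := compact_norm_le cK'.
exists (M1 + 1 + M2) => [|dt n u dt0 [Ku [Du Zu]] nT]; first lra.
have ndt0 : 0 <= n%:R * dt by rewrite mulr_ge0// ltW.
have [small|large] := leP dt theta.
  have near : `|E (n%:R * dt) u - iter n (C dt) u| <= 1.
    by apply: thetaP => //; [rewrite ndt0|rewrite subrr normr0 ltW].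
  have : `|E (n%:R * dt) u| <= M1.
    apply: M1P; exists (n%:R * dt, u) => //; split => //; split => //=.
    by rewrite in_itv /= ndt0.
  have := lerB_dist (iter n (C dt) u) (E (n%:R * dt) u).
  by rewrite distrC; lra.
suff nN : (n <= N)%N.
  have := M2P _ (K'P dt n u nN (ltW dt0) nT Ku); lra.
rewrite -(ler_nat R); apply: le_trans (ltW (truncnS_gt _)).
rewrite ler_pdivlMr//; apply: le_trans nT.
by rewrite ler_wpM2l// ltW.
Qed.

(** * From convergence to stability *)

Lemma convergent_distantly_stable D E C :
  well_posed D E -> numerical_method C -> convergent D E C ->
  distantly_stable D E C.
Proof.
move=> wp hC conv Z' rZ T T0 K cK rho rho0.
have [M M0 MP] := convergent_iterates_bounded wp hC conv rZ T0 cK.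
exists (2 * M / rho) => [|dt n u v dt0 Ku Kv nT uv].
  by rewrite divr_gt0// mulr_gt0.
have Mu := MP _ _ _ dt0 Ku nT; have Mv := MP _ _ _ dt0 Kv nT.
apply: le_trans (ler_normB _ _) _; apply: (@le_trans _ _ (2 * M)); first lra.
by rewrite mulrAC ler_pdivlMr// ler_wpM2l//; lra.
Qed.

Lemma locally_distantly_stable D E C :
  locally_stable D E C -> distantly_stable D E C -> stable D E C.
Proof.
move=> lS dS Z' rZ T T0 K cK.
have [L1 [r [L10 r0 L1P]]] := lS _ rZ _ T0 _ cK.
have [L2 L20 L2P] := dS _ rZ _ T0 _ cK _ r0.
exists (L1 + L2) => [|dt n u v dt0 Ku Kv nT]; first lra.
rewrite mulrDl; have vu0 := normr_ge0 (v - u).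
have [near|/ltW far] := leP `|v - u| r.
  apply: le_trans (L1P _ _ _ _ dt0 Ku Kv nT near) _.
  by rewrite lerDl mulr_ge0// ltW.
apply: le_trans (L2P _ _ _ _ dt0 Ku Kv nT far) _.
by rewrite lerDr mulr_ge0// ltW.
Qed.

(** * From stability and consistency to convergence *)

(** The induction on [k] compares [C^n u] with the trajectory that follows the
    semigroup for [k] steps and then the method for [n - k] steps.  Passing from
    [k] to [k + 1] changes one step, whose local error [e] is then propagated by
    the remaining [m] steps of the method with amplification [L].  Regularity of
    [Z'] puts both ends of that step in the slice at time [m dt], where
    stability applies. *)
Lemma telescoping_error D E C (Z' : set (R * X)) (L e dt : R) (n : nat) (u : X) :
  nonlinear_semigroup D E ->
  regular D E C Z' ->
  0 < dt ->
  (forall t, 0 <= t <= n%:R * dt -> slice D Z' t u) ->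
  (forall k, (k < n)%N ->
     `|C dt (E (k%:R * dt) u) - E dt (E (k%:R * dt) u)| <= e) ->
  (forall k m, (k.+1 + m)%N = n ->
     let v := E dt (E (k%:R * dt) u) in
     let w := C dt (E (k%:R * dt) u) in
     slice D Z' (m%:R * dt) v -> slice D Z' (m%:R * dt) w ->
     `|iter m (C dt) w - iter m (C dt) v| <= L * `|w - v|) ->
  0 <= L ->
  `|E (n%:R * dt) u - iter n (C dt) u| <= n%:R * (L * e).
Proof.
move=> hE rZ dt0 uZ cons stab L0.
have nat0 (k : nat) : 0 <= k%:R * dt by rewrite mulr_ge0// ltW.
have nat_le (k m : nat) : (k <= m)%N -> k%:R * dt <= m%:R * dt.
  by move=> km; rewrite ler_wpM2r ?(ltW dt0)// ler_nat.
suff partial k m : (k + m)%N = n ->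
    `|iter m (C dt) (E (k%:R * dt) u) - iter n (C dt) u| <= k%:R * (L * e).
  exact: (partial n 0 (addn0 n)).
elim: k m => [|k IH] m kmn.
  have [D0 _] : slice D Z' 0 u by apply: uZ; rewrite lexx nat0.
  by rewrite -kmn mul0r (semigroup_id hE D0) subrr normr0 mul0r.
have Euk : slice D Z' (m.+1%:R * dt) (E (k%:R * dt) u).
  apply: (regular_semigroup rZ) (nat0 k) (nat0 _) _ _; exists u => //.
  rewrite -mulrDl -natrD addnS -addSn kmn; apply: uZ.
  by rewrite nat0 lexx.
have Sm : m.+1%:R * dt = dt + m%:R * dt by rewrite -natr1 mulrDl mul1r addrC.
have stepE : E (k.+1%:R * dt) u = E dt (E (k%:R * dt) u).
  have -> : k.+1%:R * dt = k%:R * dt + dt by rewrite -natr1 mulrDl mul1r.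
  apply: (semigroup_add hE) (nat0 k) (ltW dt0) _ _.
  have [] // : slice D Z' (k%:R * dt + dt) u.
  apply: uZ; rewrite addr_ge0 ?(ltW dt0)//=.
  have -> : k%:R * dt + dt = k.+1%:R * dt by rewrite -natr1 mulrDl mul1r.
  by apply: nat_le; rewrite -kmn leq_addr.
have stepD : `|iter m (C dt) (C dt (E (k%:R * dt) u))
               - iter m (C dt) (E dt (E (k%:R * dt) u))| <= L * e.
  apply: le_trans (stab k m kmn _ _) _.
  - apply: (regular_semigroup rZ) (ltW dt0) (nat0 _) _ _.
    by exists (E (k%:R * dt) u) => //; rewrite -Sm.
  - apply: (regular_method rZ) (nat0 _) (ltW dt0) _ _.
    by exists (E (k%:R * dt) u) => //; rewrite addrC -Sm.
  - by apply: ler_wpM2l => //; apply: cons; rewrite -kmn leq_addr.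
have := IH m.+1; rewrite addnS -addSn => /(_ kmn); rewrite iterSr => step.
rewrite stepE -natr1 mulrDl mul1r [leRHS]addrC.
apply: le_trans (ler_distD (iter m (C dt) (C dt (E (k%:R * dt) u))) _ _) _.
by rewrite lerD// distrC.
Qed.

(** Stability is applied to the compact set [K1] of values of the semigroup on the
    data from [K] together with the set [K2] reached from [K1] by one step of
    the method: the telescoping sum compares one point of each.  The horizon
    [T + 1] leaves room for [n dt], which is within 1 of [t <= T].  The accuracy
    [e] makes the total error [L e (T + 1)] equal to [eps / 2]. *)
Lemma stable_convergent D E C :
  nonlinear_semigroup D E -> well_posed D E -> numerical_method C ->
  consistent D E C -> stable D E C -> convergent D E C.
Proof.
move=> hE wp hC cons stab Z' rZ T T0 K cK eps eps0.
pose T' := T + 1.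
have T'0 : 0 < T' by rewrite /T'; lra.
pose Z2 := bounded_lower_closure T' Z'.
have rZ2 : regular D E C Z2 by exact: regular_bounded_lower_closure.
have cA := compact_part_compact (T := T') cK (regular_set_closed rZ2).
have cE := compact_part_well_posed (T := T') (K := K) wp rZ2.
pose K1 := (fun p : R * X => E p.1 p.2) @` compact_part T' K Z2.
have cK1 : compact K1 by exact: continuous_compact.
pose K2 := (fun p : R * X => C p.1 p.2) @` (`[0, T'] `*` K1).
have cK2 : compact K2 by exact: method_image_compact.
have [L L0 LP] := stab _ rZ2 _ T'0 _ (compactU cK1 cK2).
pose e := eps / (2 * L * T').
have e0 : 0 < e by rewrite divr_gt0 ?mulr_gt0.
have [delta delta0 deltaP] := cons _ rZ2 _ T'0 _ cK _ e0.
have eps2 : 0 < eps / 2 by rewrite divr_gt0.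
have [d d0 dP] := compact_within_unif_continuous cA cE eps2.
(* Halving d gives the strict inequality that membership in a ball requires. *)
exists (Num.min 1 (Num.min delta (d / 2))) => [|t dt n u /andP[t0 tT] dt0].
  by rewrite !lt_min ltr01 delta0 divr_gt0.
move=> [[Ku [_ Zt]] [_ Zn]]; rewrite !le_min.
move=> /and3P[_ dt_delta _] /and3P[tn1 _ tnd].
have n0 : 0 <= n%:R * dt by rewrite mulr_ge0// ltW.
have nT : n%:R * dt <= T'.
  by move: tn1; rewrite distrC ler_distlC /T'; lra.
have below s : 0 <= s <= n%:R * dt -> Z2 (s, u).
  by move=> /andP[s0 sn]; split=> //; exists (n%:R * dt) => //=; rewrite sn.
have part s : 0 <= s <= T' -> Z2 (s, u) -> compact_part T' K Z2 (s, u).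
  by move=> sT Zs; split => //; split => //=; rewrite in_itv.
have below_slice s : 0 <= s <= n%:R * dt -> slice D Z2 s u.
  by move=> sn; have Zs := below s sn; split => //; case: (regular_sub rZ2 Zs).
have near : `|E t u - E (n%:R * dt) u| <= eps / 2.
  apply: (dP (t, u) (n%:R * dt, u)).
  - apply: part; first by rewrite t0 /T'; lra.
    by split => //; exists t => //=; rewrite lexx /T'; lra.
  - by apply: part; [rewrite n0|apply: below; rewrite n0 lexx].
  - split; last exact: ballxx.
    by rewrite -ball_normE /=; lra.
have telescope : `|E (n%:R * dt) u - iter n (C dt) u| <= n%:R * (L * (e * dt)).
  have time k : (k <= n)%N -> 0 <= k%:R * dt <= n%:R * dt.
    by move=> kn; rewrite mulr_ge0 ?(ltW dt0)//= ler_wpM2r ?(ltW dt0)// ler_nat.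
  have onK1 k : (k <= n)%N -> K1 (E (k%:R * dt) u).
    move=> kn; have /andP[k0 kn'] := time k kn.
    by exists (k%:R * dt, u) => //; apply: part;
      [rewrite k0 (le_trans kn')|apply: below; rewrite k0].
  have succ k : k%:R * dt + dt = k.+1%:R * dt by rewrite -natr1 mulrDl mul1r.
  apply: (telescoping_error hE rZ2 dt0 below_slice _ _ (ltW L0)).
  - move=> k kn; apply: deltaP => //.
    + by have /andP[-> /le_trans->] := time k (ltnW kn).
    + by split=> //; rewrite succ; apply: below_slice; exact: time.
  - move=> k m kmn v w vZ wZ.
    have kn : (k.+1 <= n)%N by rewrite -kmn leq_addr.
    have dtT : dt <= T'.
      have /andP[_ /le_trans /(_ nT)] := time k.+1 kn.
      have /andP[+ _] := time k (ltnW kn).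
      by rewrite -succ; lra.
    apply: LP => //.
    + split => //; left; rewrite /v -(semigroup_add hE) ?(ltW dt0)//.
      * by rewrite succ; exact: onK1.
      * by have /andP[] := time k (ltnW kn).
      * by rewrite succ; have [] := below_slice _ (time k.+1 kn).
    + split => //; right; exists (dt, E (k%:R * dt) u) => //; split => /=.
        by rewrite in_itv /= ltW.
      exact: onK1 (ltnW kn).
    + have mn : (m <= n)%N by rewrite -kmn leq_addl.
      by have /andP[_ /le_trans->] := time m mn.
apply: le_trans (ler_distD (E (n%:R * dt) u) _ _) _.
rewrite [leRHS](splitr eps) lerD//; apply: le_trans telescope _.
have -> : n%:R * (L * (e * dt)) = L * e * (n%:R * dt) by ring.
have -> : eps / 2 = L * e * T' by rewrite /e; field; rewrite !gt_eqF.
by rewrite ler_wpM2l// mulr_ge0// ltW.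
Qed.

End SemigroupAndMethod.

Theorem theorem4p1 (R : realType) (X : normedModType R)
    (D : R -> set X) (E : R -> X -> X)
    (hE : nonlinear_semigroup D E) (hwp : well_posed D E)
    (P : (R -> X -> X) -> Prop) (hP : condition_of_type_C D E P)
    (C : R -> X -> X) (hC : numerical_method C)
    (hcons : consistent D E C) (hPC : P C) :
  convergent D E C <-> stable D E C.
Proof.
split=> [conv|]; last exact: stable_convergent.
have dist := convergent_distantly_stable hwp hC conv.
exact: locally_distantly_stable (hP C hC hPC dist) dist.
Qed.
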